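(* Let $0<\alpha<1$ be fixed and $f_i=1/i^\alpha$ for $i\in[n]$. Let $n,B,k\in\mathbb{N}$ with $k\ge1$ and $B\le n/k$. Let $h_1,\dots,h_k:[n]\to[B]$ be independent, truly (uniformly) random hash functions, and for $i\in[n]$ define $\tilde f_i=\min_{\ell\in[k]}\big(\sum_{j\in[n]}[h_\ell(j)=h_\ell(i)]f_j\big)$. Then for every $i\in[n]$, $\mathbb{E}[|\tilde f_i-f_i|]=\Theta\!\left(\frac{n^{1-\alpha}}{B}\right)$, with implied constants depending only on $\alpha$.
   Context: $[E]$ is the indicator of event $E$. This is Count-Min on generalized Zipfian frequencies with exponent $\alpha$.
   Formalization: The lower bound is stated for n ≥ 2 only (the upper bound for all n ≥ 1), since for n = B = k = 1 the error is identically 0 while n^{1-α}/B = 1; B ≥ 1 is made explicit. *)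

(* Defs.v *)
From HB Require Import structures.
From mathcomp Require Import all_boot all_order all_algebra.
From mathcomp Require Import all_classical all_reals all_analysis.

Set Implicit Arguments.
Unset Strict Implicit.
Unset Printing Implicit Defensive.

Import Order.TTheory GRing.Theory Num.Theory.
Import numFieldNormedType.Exports.

Local Open Scope classical_set_scope.
Local Open Scope ring_scope.

(* The index [i : 'I_n] stands for the (1-based) item [i.+1] of [n]. *)
Definition zipf (R : realType) (alpha : R) (n : nat) (i : 'I_n) : R :=
  1 / (i.+1%:R `^ alpha).

Definition bucket_load (R : realType) (n B : nat) (f : 'I_n -> R)
    (g : {ffun 'I_n -> 'I_B}) (i : 'I_n) : R :=
  \sum_(j < n) (g j == g i)%:R * f j.

(* For nonnegative [f] no bucket load exceeds the total [\sum_j f j], so for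
   [0 < k] the starting value of the iterated minimum is immaterial; see
   [count_minP]. *)
Definition count_min (R : realType) (n B k : nat) (f : 'I_n -> R)
    (g : 'I_k -> {ffun 'I_n -> 'I_B}) (i : 'I_n) : R :=
  \big[Num.min/(\sum_(j < n) f j)]_(l < k) bucket_load f (g l) i.

Lemma zipf_ge0 (R : realType) (alpha : R) (n : nat) (i : 'I_n) :
  0 <= zipf alpha i.
Proof. by rewrite /zipf div1r invr_ge0 powR_ge0. Qed.

Lemma count_minP (R : realType) (n B k : nat) (f : 'I_n -> R)
    (g : 'I_k -> {ffun 'I_n -> 'I_B}) (i : 'I_n) :
  (forall j, 0 <= f j) -> (0 < k)%N ->
  (exists l, count_min f g i = bucket_load f (g l) i) /\
  (forall l, count_min f g i <= bucket_load f (g l) i).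
Proof.
move=> f0 k0; split; last by move=> l; exact: bigmin_le.
have load_le l : bucket_load f (g l) i <= \sum_(j < n) f j.
  by apply: ler_sum => j _; rewrite ler_piMl // lern1 leq_b1.
have [l _ eq_l] : {l | l \in xpredT &
    count_min f g i = bucket_load f (g l) i}.
  by apply: (eq_bigmin (Ordinal k0)) => // l _; exact: load_le.
by exists l.
Qed.

(* Random elements of a finite type [S], which carries the discrete
   sigma-algebra: measurability is measurability of the preimages of points,
   and every subset of [S] is an admissible event in the product rule. *)
Section discrete_random_elements.
Context (d : measure_display) (T : measurableType d) (R : realType).
Variable P : probability T R.
Local Open Scope ereal_scope.

Definition random_element (S : finType) (X : T -> S) : Prop :=
  forall s : S, measurable (X @^-1` [set s]).

Definition uniformly_distributed (S : finType) (X : T -> S) : Prop :=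
  forall s : S, P (X @^-1` [set s]) = ((#|S|%:R)^-1)%:E.

Definition mutually_independent (I S : finType) (X : I -> T -> S) : Prop :=
  forall (J : {set I}) (A : I -> set S),
    P (\bigcap_(l in [set` J]) (X l @^-1` A l))
    = \prod_(l in J) P (X l @^-1` A l).

End discrete_random_elements.

(* Main.v *)
(** Write [X_l] for the mass of the items other than [i] hashed by [h_l] to the
    bucket of [i]; the error is the minimum of the [X_l].  It is at most [X_1],
    whose mean is at most [B^-1 * \sum_j f_j <= n^(1-alpha) / ((1-alpha) B)].
    Conversely [X_l >= n^(-alpha) Y_l], where [Y_l] is binomial with mean
    [m = (n-1)/B].  The Chernoff bound [P(Y_l < m/4) <= exp(-m/4)], together with
    [1 - exp(-x) >= exp(-1/x)], gives [P(Y_l >= m/4)^k >= exp(-4k/m) >= exp(-8)],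
    because [k B <= n <= 2(n-1)]. *)

Require Import Defs.
From HB Require Import structures.
From mathcomp Require Import all_boot all_order all_algebra.
From mathcomp Require Import all_classical all_reals all_analysis.
From mathcomp Require Import measurable_realfun ring lra.

Set Implicit Arguments.
Unset Strict Implicit.
Unset Printing Implicit Defensive.

Import Order.TTheory GRing.Theory Num.Theory.
Import numFieldNormedType.Exports.
Local Open Scope ring_scope.

(** * Reduction of probabilities and expectations to finite averages *)

Section finite_random_elements.
Local Open Scope classical_set_scope.
Context (d : measure_display) (T : measurableType d) (R : realType).
Variable P : probability T R.

Lemma random_element_preimage (S : finType) (X : T -> S) (A : set S) :
  random_element X -> measurable (X @^-1` A).
Proof.
move=> mX.
have -> : X @^-1` A = \bigcup_(s in A) X @^-1` [set s].
  by apply/seteqP; split => [w Aw|w [s As /= ->]//]; exists (X w).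
by apply: fin_bigcup_measurable => // s _; exact: mX.
Qed.

Lemma measurable_random_element_comp (S : finType) (X : T -> S) (phi : S -> R) :
  random_element X -> measurable_fun [set: T] (fun w => phi (X w)).
Proof.
move=> mX _ Y _; rewrite setTI.
exact: (random_element_preimage (phi @^-1` Y) mX).
Qed.

Lemma random_element_family (I S : finType) (X : I -> T -> S) :
  (forall l, random_element (X l)) ->
  random_element (fun w => [ffun l => X l w]).
Proof.
move=> mX s.
have -> : (fun w => [ffun l => X l w]) @^-1` [set s] =
    \bigcap_(l in [set: I]) X l @^-1` [set s l].
  apply/seteqP; split => [w /= <- l _ /=|w sX /=]; first by rewrite ffunE.
  by apply/ffunP => l; rewrite ffunE; exact: sX.
by apply: fin_bigcap_measurable => // l _; exact: mX.
Qed.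

Definition average (S : finType) (phi : S -> R) : R :=
  #|S|%:R^-1 * \sum_s phi s.

(** [phi (X w)] is a finite combination of indicators of the fibres of [X], and every fibre has
    measure [1/#|S|]; integrate termwise. *)
Lemma expectation_uniform (S : finType) (X : T -> S) (phi : S -> R) :
  random_element X -> uniformly_distributed P X -> (forall s, 0 <= phi s) ->
  'E_P[fun w => phi (X w)]%E = (average phi)%:E.
Proof.
move=> mX uX phi0; rewrite unlock.
have -> : (fun w => (phi (X w))%:E) =
    (fun w => \sum_(s : S) ((phi s)%:E * (\1_(X @^-1` [set s]) w)%:E)%E)%E.
  apply/funext => w; rewrite (bigD1 (X w)) //= big1 => [|s sX].
    by rewrite adde0 indicE mem_set //= mule1.
  by rewrite indicE memNset ?mule0 //= => /esym/eqP; exact/negP.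
have m1 s : measurable_fun [set: T] (\1_(X @^-1` [set s]) : T -> R).
  exact: measurable_indic (mX s).
rewrite ge0_integral_sum; first 1 last.
- by [].
- by move=> s; apply/measurable_EFinP; apply: measurable_funM.
- by move=> s w _; rewrite -EFinM lee_fin mulr_ge0.
rewrite /average mulr_sumr -sumEFin; apply: eq_bigr => s _.
rewrite ge0_integralZl_EFin //; last exact/measurable_EFinP.
rewrite (integral_indic _ measurableT (mX s)) setIT.
by rewrite [X in (_ * X)%E]uX -EFinM mulrC.
Qed.

Lemma probability_uniform (S : finType) (X : T -> S) (A : pred S) :
  random_element X -> uniformly_distributed P X ->
  P (X @^-1` [set s | A s]) = (average (fun s => (A s)%:R))%:E.
Proof.
move=> mX uX; rewrite -(expectation_uniform mX uX) // -expectation_indic; last first.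
  exact: random_element_preimage.
by congr ('E_P[_])%E; apply/funext => w; rewrite indicE mem_setE.
Qed.

End finite_random_elements.

(** * Collision counts of a uniform hash function *)

Section uniform_averages.
Variables (R : realType) (n B : nat).
Hypothesis B_gt0 : (0 < B)%N.
Implicit Types i j : 'I_n.

Lemma average_cst (S : finType) (c : R) : (0 < #|S|)%N ->
  average (fun _ : S => c) = c.
Proof.
by move=> S0; rewrite /average sumr_const -[c *+ _]mulr_natl mulKf // pnatr_eq0 -lt0n.
Qed.

Lemma average_le (S : finType) (phi psi : S -> R) :
  (forall s, phi s <= psi s) -> average phi <= average psi.
Proof. by move=> h; rewrite ler_wpM2l ?invr_ge0 ?ler0n// ler_sum. Qed.

Lemma averageZ (S : finType) (c : R) (phi : S -> R) :
  average (fun s => c * phi s) = c * average phi.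
Proof. by rewrite /average -mulr_sumr mulrCA. Qed.

Lemma average_eq (S : finType) (a : S) :
  average (fun s => (s == a)%:R) = #|S|%:R^-1 :> R.
Proof.
rewrite /average (bigD1 a) //= eqxx big1 ?addr0 ?mulr1 // => s /negbTE ->.
by [].
Qed.

(* Conditionally on [g i], the other values of a uniform [g] are independent. *)
Lemma average_prod i (psi : 'I_B -> 'I_n -> 'I_B -> R) :
  average (fun g : {ffun 'I_n -> 'I_B} => \prod_(j | j != i) psi (g i) j (g j)) =
  average (fun b => \prod_(j | j != i) average (psi b j)).
Proof.
rewrite /average card_ffun !card_ord.
(* The value [b] of [g i] becomes a summation variable, enforced by an indicator factor at [i]. Each
   summand is then a product over all indices, so sum and product can be exchanged. *)
pose F b j c := if j == i then (c == b)%:R else psi b j c : R.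
have -> : \sum_(g : {ffun 'I_n -> 'I_B}) \prod_(j | j != i) psi (g i) j (g j) =
    \sum_(g : {ffun 'I_n -> 'I_B}) \sum_b \prod_j F b j (g j).
  apply: eq_bigr => g _; rewrite (bigD1 (g i)) //= [X in _ + X]big1 ?addr0.
    rewrite [RHS](bigD1 i) //= {1}/F eqxx eqxx mul1r.
    by apply: eq_bigr => j /negbTE; rewrite /F => ->.
  by move=> b bg; rewrite (bigD1 i) //= /F eqxx eq_sym (negbTE bg) mul0r.
rewrite exchange_big /= !mulr_sumr; apply: eq_bigr => b _.
rewrite -bigA_distr_bigA (bigD1 i) //= {1}/F eqxx.
rewrite (bigD1 b) //= eqxx big1 ?addr0 ?mul1r => [|c /negbTE -> //].
rewrite big_split /= prodr_const.
have -> : #|[pred j | j != i]| = n.-1 by rewrite cardC1 card_ord.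
rewrite mulrA; congr (_ * _).
  (* Of the [n] factors [1/B], one averages over [b] and the other [n-1] average over the values at
     [j != i]. *)
  by rewrite -{1}(ltn_predK (ltn_ord i)) exprVn -invfM -exprS natrX.
apply: eq_bigr => j /negbTE ji; apply: eq_bigr => c _.
by rewrite /F ji.
Qed.

(** Apply [average_prod] with every factor but the one at [j] equal to 1: once [g i] is fixed to
    [b], what remains is the chance that a uniform bucket equals [b]. *)
Lemma average_collision i j : j != i ->
  average (fun g : {ffun 'I_n -> 'I_B} => (g j == g i)%:R) = B%:R^-1 :> R.
Proof.
move=> ji.
pose psi (b : 'I_B) (j' : 'I_n) (c : 'I_B) : R := if j' == j then (c == b)%:R else 1.
transitivity (average (fun g : {ffun 'I_n -> 'I_B} =>
    \prod_(j' | j' != i) psi (g i) j' (g j'))).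
  congr average; apply/funext => g.
  rewrite (bigD1 j) //= {1}/psi eqxx big1 ?mulr1 // => j' /andP[_ /negbTE].
  by rewrite /psi => ->.
rewrite average_prod -[RHS](@average_cst 'I_B) ?card_ord //.
congr average; apply/funext => b.
rewrite (bigD1 j) //= big1 ?mulr1 => [|j' /andP[_ /negbTE jj']].
  by rewrite /psi eqxx average_eq card_ord.
by rewrite /psi jj' average_cst // card_ord.
Qed.

(** For uniform [g] this is binomial with [n-1] trials of success probability [1/B]. *)
Definition collisions (g : {ffun 'I_n -> 'I_B}) i : R :=
  \sum_(j | j != i) (g j == g i)%:R.

(** The Laplace transform of the binomial law at 1 is [(1 - (1 - 1/e)/B)^(n-1)]. Since
    [1 - 1/e >= 1/2], each factor is at most [1 - 1/(2B) <= expR (- 1/(2B))]. *)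
Lemma average_expRN_collisions i :
  average (fun g => expR (- collisions g i)) <= expR (- (n.-1%:R / B%:R / 2)).
Proof.
pose psi (b : 'I_B) (j : 'I_n) (c : 'I_B) : R := 1 - (1 - expR (-1)) * (c == b)%:R.
have -> : (fun g => expR (- collisions g i)) =
    fun g : {ffun 'I_n -> 'I_B} => \prod_(j | j != i) psi (g i) j (g j).
  apply/funext => g; rewrite /collisions -sumrN expR_sum.
  apply: eq_bigr => j _; rewrite /psi; case: eqP => _.
    by rewrite mulr1 opprB addrC subrK.
  by rewrite mulr0 oppr0 addr0 expR0.
rewrite average_prod -[leRHS](@average_cst 'I_B) ?card_ord //.
apply: average_le => b.
have e2 : expR (-1) <= 2^-1 :> R.
  rewrite expRN lef_pV2 ?posrE ?expR_gt0 //.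
  by have := @expR_ge1Dx R 1; lra.
have e0 : 0 < expR (-1) :> R by exact: expR_gt0.
have avg (j : 'I_n) : average (psi b j) = 1 - (1 - expR (-1)) / B%:R.
  rewrite -[in RHS](card_ord B) -(average_eq b) -averageZ /average /psi.
  rewrite sumrB mulrBr; congr (_ - _).
  by rewrite -/(average (fun _ => 1)) average_cst // card_ord.
rewrite (eq_bigr (fun=> 1 - (1 - expR (-1)) / B%:R)) => [|j _]; last exact: avg.
rewrite prodr_const.
have -> : #|[pred j | j != i]| = n.-1 by rewrite cardC1 card_ord.
have -> : - (n.-1%:R / B%:R / 2) = n.-1%:R * (- (2^-1 / B%:R)) :> R by ring.
have B0 : 0 < B%:R^-1 :> R by rewrite invr_gt0 ltr0n.
have B1 : B%:R^-1 <= 1 :> R by rewrite invf_le1 ?ltr0n ?ler1n.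
rewrite expRM_natl lerXn2r ?nnegrE ?expR_ge0 //; first by nra.
apply: le_trans (expR_ge1Dx _).
by nra.
Qed.

(* Markov's inequality for [expR (- collisions g i)] *)
Lemma average_few_collisions i :
  average (fun g => (collisions g i < n.-1%:R / B%:R / 4)%R%:R) <=
  expR (- (n.-1%:R / B%:R / 4)) :> R.
Proof.
set x := n.-1%:R / B%:R / 4.
(* The threshold [x] is half the exponent of the preceding bound, so the Markov factor [expR x]
   leaves exactly [expR (- x)]. *)
have -> : expR (- x) = expR x * expR (- (n.-1%:R / B%:R / 2)).
  by rewrite -expRD; congr expR; rewrite /x; set y := n.-1%:R / B%:R; lra.
apply: (@le_trans _ _ (average (fun g => expR x * expR (- collisions g i)))).
  apply: average_le => g; case: ltP => [lt_gx|_] /=; last first.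
    by rewrite mulr_ge0 ?expR_ge0.
  by rewrite -expRD -expR0 ler_expR; lra.
by rewrite averageZ ler_wpM2l ?expR_ge0 ?average_expRN_collisions.
Qed.

Lemma average_many_collisions i :
  1 - expR (- (n.-1%:R / B%:R / 4)) <=
  average (fun g => (n.-1%:R / B%:R / 4 <= collisions g i)%R%:R) :> R.
Proof.
rewrite lerBlDr -lerBlDl; apply: le_trans (average_few_collisions i).
have S0 : (0 < #|{: {ffun 'I_n -> 'I_B}}|)%N.
  by rewrite card_ffun !card_ord expn_gt0 B_gt0.
rewrite -[X in X - _](average_cst _ S0) /average -mulrBr -sumrB.
apply: average_le => g.
by case: (leP _ (collisions g i)) => _; rewrite /= ?subr0 ?subrr.
Qed.

End uniform_averages.

(** * Estimates for powers, Zipfian sums and exponentials *)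

Section real_inequalities.
Variable R : realType.

(** Young's inequality for [a^s] and 1 with conjugate exponents [1/s] and [1/(1-s)]; the right side
    is the tangent of the concave function [a^s] at [a = 1]. *)
Lemma powR_le_tangent (a s : R) : 0 <= a -> 0 < s -> s < 1 ->
  a `^ s <= s * a + (1 - s).
Proof.
move=> a0 s0 s1.
have s'0 : 0 < 1 - s by lra.
have := @conjugate_powR _ (a `^ s) 1 s^-1 (1 - s)^-1 (powR_ge0 _ _) ler01.
rewrite !invr_gt0 => /(_ s0 s'0); rewrite !invrK => /(_ ltac:(lra)).
rewrite mulr1 -powRrM divff ?gt_eqF // powRr1 // powR1; lra.
Qed.

(** A discrete form of comparison with the integral of [x^(-alpha)]. The induction step needs
    [(1-alpha) m^(-alpha) <= m^(1-alpha) - (m-1)^(1-alpha)], which is the tangent bound at [(m-1)/m]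
    scaled by [m^(1-alpha)]. *)
Lemma sum_zipf_le (alpha : R) (n : nat) : 0 < alpha -> alpha < 1 ->
  \sum_(j < n) zipf alpha j <= n%:R `^ (1 - alpha) / (1 - alpha).
Proof.
move=> a0 a1.
have s0 : 0 < 1 - alpha by lra.
rewrite ler_pdivlMr //; elim: n => [|n IHn].
  by rewrite big_ord0 mul0r powR_ge0.
rewrite big_ord_recr /= mulrDl.
rewrite [in X in _ + X]/zipf /= [in X in _ + X]div1r -powRN.
set m : R := n.+1%:R.
have m0 : 0 < m by rewrite ltr0n.
have := @powR_le_tangent (n%:R / m) (1 - alpha).
rewrite divr_ge0 ?ler0n ?(ltW m0) // s0 => /(_ isT isT ltac:(lra)) tangent.
have nE : n%:R `^ (1 - alpha) = (n%:R / m) `^ (1 - alpha) * m `^ (1 - alpha).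
  by rewrite -powRM ?divr_ge0 ?ler0n ?(ltW m0) // divfK // gt_eqF.
have mE : m `^ (1 - alpha) = m * m `^ (- alpha).
  by rewrite powRD ?powRr1 ?(ltW m0) // gt_eqF ?implybT.
have nm : n%:R = m - 1 by rewrite /m -natr1 addrK.
have step : n%:R `^ (1 - alpha) <= m `^ (1 - alpha) - m `^ (- alpha) * (1 - alpha).
  rewrite nE (le_trans (ler_wpM2r (powR_ge0 _ _) tangent)) // mE nm.
  have -> : ((1 - alpha) * ((m - 1) / m) + (1 - (1 - alpha))) * (m * m `^ (- alpha)) =
      m * m `^ (- alpha) - m `^ (- alpha) * (1 - alpha); last by [].
    by field; rewrite gt_eqF.
by have := le_trans IHn step; rewrite /zipf /=; lra.
Qed.

Lemma zipf_ge (alpha : R) (n : nat) (j : 'I_n) : 0 <= alpha ->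
  n%:R `^ (- alpha) <= zipf alpha j.
Proof.
move=> a0; rewrite /zipf div1r powRN lef_pV2 ?posrE ?powR_gt0 ?ltr0n //.
  by rewrite ge0_ler_powR ?nnegrE ?ler0n // ler_nat.
exact: leq_ltn_trans (ltn_ord j).
Qed.

(** The number [x/(1+x)], which is both [1/(1 + 1/x)] and [1 - 1/(1+x)], separates the two sides:
    use [1 + y <= expR y] at [y = 1/x] and at [y = x]. *)
Lemma expRNV_le (x : R) : 0 < x -> expR (- x^-1) <= 1 - expR (- x).
Proof.
move=> x0; rewrite !expRN.
have ex : 1 + x <= expR x by exact: expR_ge1Dx.
have eV : 1 + x^-1 <= expR x^-1 by exact: expR_ge1Dx.
have xV : 0 < x^-1 by rewrite invr_gt0.
apply: (@le_trans _ _ (1 + x^-1)^-1).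
  by rewrite lef_pV2 ?posrE ?expR_gt0 //; lra.
apply: (@le_trans _ _ (1 - (1 + x)^-1)).
  have -> : (1 + x^-1)^-1 = 1 - (1 + x)^-1 by field; rewrite !gt_eqF //; lra.
  by [].
by rewrite lerD2l lerN2 lef_pV2 ?posrE ?expR_gt0 //; lra.
Qed.

End real_inequalities.

(** * The error as a minimum of overloads *)

Section overload.
Variables (R : realType) (n B : nat) (f : 'I_n -> R).
Hypothesis f_ge0 : forall j, 0 <= f j.

Definition overload (g : {ffun 'I_n -> 'I_B}) (i : 'I_n) : R :=
  \sum_(j | j != i) (g j == g i)%:R * f j.

Lemma overload_ge0 g i : 0 <= overload g i.
Proof. by apply: sumr_ge0 => j _; rewrite mulr_ge0. Qed.

Lemma bucket_loadE g i : bucket_load f g i = f i + overload g i.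
Proof. by rewrite /bucket_load (bigD1 i) //= eqxx mul1r. Qed.

Lemma average_overload_le i : (0 < B)%N ->
  average (overload ^~ i) <= B%:R^-1 * \sum_j f j.
Proof.
move=> B0; rewrite /average /overload exchange_big /= mulr_sumr.
have -> : \sum_(j | j != i) #|{: {ffun 'I_n -> 'I_B}}|%:R^-1 *
      (\sum_(g : {ffun 'I_n -> 'I_B}) (g j == g i)%:R * f j) =
    B%:R^-1 * \sum_(j | j != i) f j.
  rewrite mulr_sumr; apply: eq_bigr => j ji.
  by rewrite -mulr_suml mulrA -(average_collision _ B0 ji).
rewrite ler_wpM2l ?invr_ge0 ?ler0n // [leRHS](bigD1 i) //= lerDr; exact: f_ge0.
Qed.

Lemma overload_ge_collisions c g i : (forall j, c <= f j) ->
  c * collisions R g i <= overload g i.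
Proof.
move=> cf; rewrite /collisions mulr_sumr; apply: ler_sum => j _.
by rewrite mulrC ler_wpM2l.
Qed.

Variables (k : nat) (h : 'I_k -> {ffun 'I_n -> 'I_B}) (i : 'I_n).
Hypothesis k_gt0 : (0 < k)%N.

(** The minimum is attained at some row [l'], so the error is the overload of that row; it is
    nonnegative and the absolute value disappears. *)
Lemma count_min_error_le l : `|count_min f h i - f i| <= overload (h l) i.
Proof.
have [[l' cE] /(_ l)] := count_minP h i f_ge0 k_gt0.
rewrite cE !bucket_loadE lerD2l addrC addKr.
by rewrite ger0_norm // overload_ge0.
Qed.

Lemma count_min_error_ge t : (forall l, t <= overload (h l) i) ->
  t <= `|count_min f h i - f i|.
Proof.
move=> th; have [[l ->] _] := count_minP h i f_ge0 k_gt0.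
by rewrite bucket_loadE addrC addKr ger0_norm ?overload_ge0.
Qed.

End overload.

(** * Bounds on the expected error for general nonnegative frequencies *)

Section expected_error.
Local Open Scope classical_set_scope.
Context (d : measure_display) (T : measurableType d) (R : realType).
Variables (P : probability T R) (n B k : nat) (f : 'I_n -> R).
Variable h : 'I_k -> T -> {ffun 'I_n -> 'I_B}.
Hypotheses (B_gt0 : (0 < B)%N) (k_gt0 : (0 < k)%N).
Hypothesis f_ge0 : forall j, 0 <= f j.
Hypothesis h_random : forall l, random_element (h l).
Hypothesis h_uniform : forall l, uniformly_distributed P (h l).

Let error (i : 'I_n) (w : T) : R := `|count_min f (fun l => h l w) i - f i|.

Lemma measurable_count_min_error i : measurable_fun [set: T] (error i).
Proof.
(* Bundling the [k] hash functions into one finite function makes the error a function of a single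
   random element of a finite type. *)
have -> : error i = fun w =>
    `|count_min f [ffun l => h l w] i - f i|.
  apply/funext => w; rewrite /error; congr (`|count_min _ _ _ - _|).
  by apply/funext => l; rewrite ffunE.
apply: (measurable_random_element_comp
  (fun g : {ffun 'I_k -> {ffun 'I_n -> 'I_B}} => `|count_min f g i - f i|)).
exact: random_element_family.
Qed.

Lemma expected_error_le i :
  ('E_P[error i] <= (B%:R^-1 * \sum_j f j)%:E)%E.
Proof.
(* A single row already bounds the minimum; [k_gt0] provides row 0. *)
apply: (@le_trans _ _ 'E_P[fun w => overload f (h (Ordinal k_gt0) w) i]%E).
  apply: expectation_le.
  - exact: measurable_count_min_error.
  - exact: (measurable_random_element_comp (fun g => overload f g i)).
  - by move=> w; exact: normr_ge0.
  - by move=> w; exact: overload_ge0.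
  - by apply: aeW => w; exact: count_min_error_le.
rewrite (expectation_uniform (phi := overload f ^~ i)) //.
  by rewrite lee_fin average_overload_le.
by move=> g; exact: overload_ge0.
Qed.

Hypothesis h_independent : mutually_independent P h.

(** On the event [A] that every row has at least [x] collisions, all overloads, hence also the
    error, are at least [c * x]. Independence bounds [P A] below by a [k]-th power. *)
Lemma expected_error_ge i (c : R) : 0 <= c -> (forall j, c <= f j) ->
  ((c * (n.-1%:R / B%:R / 4) * (1 - expR (- (n.-1%:R / B%:R / 4))) ^+ k)%:E
   <= 'E_P[error i])%E.
Proof.
move=> c0 cf; set x : R := n.-1%:R / B%:R / 4.
have x0 : 0 <= x by rewrite /x !divr_ge0 ?ler0n.
pose G := [set g : {ffun 'I_n -> 'I_B} | x <= collisions R g i].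
(* The intersection runs over the full finite set, in the shape of [mutually_independent]. *)
pose A := \bigcap_(l in [set` [set: 'I_k]%SET]) h l @^-1` G.
have mA : measurable A.
  apply: fin_bigcap_measurable => // l _; exact: random_element_preimage.
have PA : (((1 - expR (- x)) ^+ k)%:E <= P A)%E.
  rewrite h_independent.
  rewrite (eq_bigr (fun=> (average
    (fun g : {ffun 'I_n -> 'I_B} => (x <= collisions R g i)%R%:R))%:E)); last first.
    move=> l _; exact: (probability_uniform
      (fun g : {ffun 'I_n -> 'I_B} => x <= collisions R g i) _ (h_uniform l)).
  rewrite prodEFin prodr_const cardsT card_ord lee_fin lerXn2r ?nnegrE //.
  - by rewrite subr_ge0 -expR0 ler_expR oppr_le0.
  - by rewrite mulr_ge0 ?invr_ge0 ?ler0n // sumr_ge0.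
  - exact: average_many_collisions.
have cx0 : 0 <= c * x by rewrite mulr_ge0.
have m1 : measurable_fun [set: T] (\1_A : T -> R) by exact: measurable_indic.
apply: (@le_trans _ _ ((c * x)%:E * P A)%E).
  by rewrite EFinM lee_wpmul2l.
have -> : ((c * x)%:E * P A)%E = 'E_P[fun w => (c * x * \1_A w)%R]%E.
  rewrite unlock -[X in P X]setIT -(integral_indic _ measurableT mA).
  by rewrite -ge0_integralZl_EFin //; exact/measurable_EFinP.
apply: expectation_le.
- exact: measurable_funM.
- exact: measurable_count_min_error.
- by move=> w; rewrite mulr_ge0.
- by move=> w; exact: normr_ge0.
apply: aeW => w; rewrite indicE.
case: (boolP (w \in A)) => [/set_mem Aw|_]; last by rewrite mulr0 normr_ge0.
rewrite mulr1; apply: count_min_error_ge => // l.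
apply: le_trans (overload_ge_collisions _ _ cf).
by rewrite ler_wpM2l //; apply: Aw; rewrite /= inE.
Qed.

End expected_error.

(** The lower bound is restricted to [1 < n] because a single item has nothing to collide with, so
    its error is zero. *)
Theorem theoremA1 (R : realType) (alpha : R) (alpha_gt0 : 0 < alpha)
    (alpha_lt1 : alpha < 1) :
  exists c C : R, 0 < c /\ 0 < C /\
    forall (n B k : nat), (0 < B)%N -> (1 <= k)%N -> B%:R <= n%:R / k%:R :> R ->
    forall (d : measure_display) (T : measurableType d) (P : probability T R)
      (h : 'I_k -> T -> {ffun 'I_n -> 'I_B}),
      (forall l, random_element (h l)) ->
      (forall l, uniformly_distributed P (h l)) ->
      mutually_independent P h ->
    forall i : 'I_n,
      let f := zipf alpha (n := n) in
      let err := fun w : T => `|count_min f (fun l => h l w) i - f i| in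
      ('E_P[err] <= (C * (n%:R `^ (1 - alpha) / B%:R))%:E)%E /\
      ((1 < n)%N -> ((c * (n%:R `^ (1 - alpha) / B%:R))%:E <= 'E_P[err])%E).
Proof.
(* The factor [1/8] combines the threshold [m/4] with [n-1 >= n/2]; [expR (- 8)] bounds the
   probability that all rows reach the threshold. The upper constant comes from [sum_zipf_le]. *)
exists (expR (- 8) / 8), (1 - alpha)^-1.
have s0 : 0 < 1 - alpha by lra.
split; first by rewrite divr_gt0 ?expR_gt0.
split; first by rewrite invr_gt0.
move=> n B k B0 k0 Bnk d T P h rh uh ih i /=; split => [|n1].
  apply: le_trans (expected_error_le B0 k0 (@zipf_ge0 R alpha n) rh uh i) _.
  rewrite lee_fin mulrA [leRHS]mulrC ler_wpM2l ?invr_ge0 ?ler0n //.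
  by rewrite [leRHS]mulrC sum_zipf_le.
apply: le_trans (expected_error_ge B0 k0 (@zipf_ge0 R alpha n) rh uh ih i
  (powR_ge0 n%:R (- alpha)) (fun j => zipf_ge j (ltW alpha_gt0))).
rewrite lee_fin; set x : R := n.-1%:R / B%:R / 4.
have BR : 0 < B%:R :> R by rewrite ltr0n.
have kR : 0 < k%:R :> R by rewrite ltr0n.
have nE : n%:R = n.-1%:R + 1 :> R by rewrite natr1 prednK // ltnW.
have m1 : 1 <= n.-1%:R :> R by rewrite ler1n -ltnS prednK // ltnW.
have x0 : 0 < x by rewrite !divr_gt0 //; lra.
have x8 : n%:R / B%:R / 8 <= x.
  have -> : n%:R / B%:R / 8 = n%:R / 2 / B%:R / 4 :> R by field; rewrite gt_eqF.
  by rewrite /x !ler_pM2r ?invr_gt0 // nE; lra.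
(* The hypothesis on [B] gives [k <= n/B], and [n/B <= 8x] by [x8]. This keeps the [k]-th power
   below bounded away from 0 uniformly in [k]. *)
have kx : k%:R / x <= 8.
  rewrite ler_pdivrMr //; apply: (@le_trans _ _ (n%:R / B%:R)); last by lra.
  by rewrite ler_pdivlMr // mulrC -ler_pdivlMr.
have powk : expR (- 8) <= (1 - expR (- x)) ^+ k.
  apply: (@le_trans _ _ (expR (- x^-1) ^+ k)).
    by rewrite -expRM_natl ler_expR mulrN lerN2.
  by rewrite lerXn2r ?nnegrE ?expR_ge0 ?expRNV_le // (le_trans (expR_ge0 _) (expRNV_le x0)).
have powE : n%:R `^ (1 - alpha) = n%:R * n%:R `^ (- alpha).
  by rewrite powRD ?powRr1 ?ler0n // pnatr_eq0 -lt0n (ltnW n1) implybT.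
have -> : expR (- 8) / 8 * (n%:R `^ (1 - alpha) / B%:R) =
    n%:R `^ (- alpha) * (n%:R / B%:R / 8) * expR (- 8).
  by rewrite powE; field; rewrite gt_eqF.
by apply: ler_pM => //; rewrite ?expR_ge0 ?ler_wpM2l ?powR_ge0 //.
Qed.
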